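(* Let $m\ge1$, $\Sigma=\{1,2,\ldots,m\}$, let $\mu:\Sigma^*\to\Sigma^*$ be a morphism and $M$ its frequency matrix. Suppose that $\mu(1)=1x$ for some $x\in\Sigma^+$, that $|\mu(a)|>1$ for all $a\in\Sigma$, that $M$ is non-singular, and that $|M^{-1}|<1$. Then, for a given positive integer $k$, it is decidable whether $\mu^\omega(1)$ is Abelian $k$-power free; that is, there is an algorithm which, given such $\mu$ and $k$, decides whether the infinite word $\mu^\omega(1)$ contains a factor that is an Abelian $k$-power.
   Context: The frequency matrix $M$ of $\mu$ is the $m\times m$ matrix with $M_{i,j}=|\mu(i)|_j$, the number of occurrences of letter $j$ in $\mu(i)$. For a real matrix $A$, $|A|=\sup_{v\in\mathbb{R}^m, v\neq0}|vA|/|v|$, where $v$ ranges over row vectors and $|v|$ is the Euclidean norm. $\mu^\omega(1)$ denotes the infinite fixed point of $\mu$ beginning with $1$. Two words $u,v$ are anagrams, $u\sim v$, if $|u|_a=|v|_a$ for all $a\in\Sigma$. An Abelian $k$-power is a non-empty word of the form $X_1X_2\cdots X_k$ with $X_i\sim X_{i+1}$ for $1\le i\le k-1$; a word is Abelian $k$-power free if none of its factors is an Abelian $k$-power. *)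

(* Defs.v *)
From HB Require Import structures.
From mathcomp Require Import all_boot all_order all_algebra.
From mathcomp Require Import Rstruct.
From Stdlib Require Rdefinitions.
Notation R := Rdefinitions.R.
Local Open Scope ring_scope.
Set Implicit Arguments. Unset Strict Implicit. Unset Printing Implicit Defensive.
Import Order.TTheory GRing.Theory Num.Theory.

(* "Decidable" = computed by a mu-recursive program that halts on every      *)
(* relevant input with output 1 (yes) / 0 (no).                              *)

Inductive prf : Type :=
| PZero
| PSucc
| PProj of nat
| PComp of prf & list prf
| PPrim of prf & prf
| PMu of prf.

Inductive prf_eval : prf -> seq nat -> nat -> Prop :=
| ev_zero args : prf_eval PZero args 0
| ev_succ args : prf_eval PSucc args (head 0%N args).+1
| ev_proj i args : prf_eval (PProj i) args (nth 0%N args i)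
| ev_comp f gs args ys z :
    prf_evals gs args ys -> prf_eval f ys z -> prf_eval (PComp f gs) args z
| ev_prim0 f g rest z :
    prf_eval f rest z -> prf_eval (PPrim f g) (0%N :: rest) z
| ev_primS f g n rest r z :
    prf_eval (PPrim f g) (n :: rest) r ->
    prf_eval g (n :: r :: rest) z ->
    prf_eval (PPrim f g) (n.+1 :: rest) z
| ev_mu f args n :
    prf_eval f (n :: args) 0%N ->
    (forall i, (i < n)%N -> exists y, prf_eval f (i :: args) y.+1) ->
    prf_eval (PMu f) args n
with prf_evals : list prf -> seq nat -> seq nat -> Prop :=
| evs_nil args : prf_evals [::] args [::]
| evs_cons g gs args y ys :
    prf_eval g args y -> prf_evals gs args ys -> prf_evals (g :: gs) args (y :: ys).

Definition cantor_pair (x y : nat) : nat := (((x + y) * (x + y).+1) %/ 2 + y)%N.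

Fixpoint encode_seq (s : seq nat) : nat :=
  match s with
  | [::] => 0%N
  | x :: s' => (cantor_pair x (encode_seq s')).+1
  end.

(* A morphism mu on {1,...,m} is given by the list of its images
   [:: mu(1); ...; mu(m)], each a word (seq nat) over {1,...,m}. *)
Definition encode_morphism (mu : seq (seq nat)) : nat :=
  encode_seq (map encode_seq mu).

Definition word_over (m : nat) (w : seq nat) : bool :=
  all (fun a => (1 <= a <= m)%N) w.

Definition img (mu : seq (seq nat)) (a : nat) : seq nat := nth [::] mu a.-1.

Definition morph_apply (mu : seq (seq nat)) (w : seq nat) : seq nat :=
  flatten (map (img mu) w).

(* mu^omega(1): letter at position n (0-based) of the infinite fixed point
   beginning with 1, read off the finite prefix mu^(n+1)(1), which has length
   > n when |mu(a)| > 1 for all a and mu(1) begins with 1. *)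
Definition omega_word (mu : seq (seq nat)) (n : nat) : nat :=
  nth 0%N (iter n.+1 (morph_apply mu) [:: 1%N]) n.

Definition omega_factor (mu : seq (seq nat)) (i len : nat) : seq nat :=
  [seq omega_word mu j | j <- iota i len].

Definition anagram (u v : seq nat) : Prop :=
  forall a : nat, count_mem a u = count_mem a v.

Definition abelian_power (k : nat) (w : seq nat) : Prop :=
  w != [::] /\
  exists X : seq (seq nat),
    size X = k /\ w = flatten X /\
    forall i, (i.+1 < k)%N -> anagram (nth [::] X i) (nth [::] X i.+1).

Definition omega_abelian_power_free (mu : seq (seq nat)) (k : nat) : Prop :=
  forall i len, ~ abelian_power k (omega_factor mu i len).

(* M_{i,j} = |mu(i)|_j, indices shifted: row i : 'I_m is letter i+1 *)
Definition freq_matrix (m : nat) (mu : seq (seq nat)) : 'M[R]_m :=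
  \matrix_(i < m, j < m) ((count_mem (j.+1 : nat) (img mu i.+1))%:R : R).

Definition vnorm (n : nat) (v : 'rV[R]_n) : R :=
  Num.sqrt (\sum_(j < n) v ord0 j ^+ 2).

(* |A| < 1 where |A| = sup_{v <> 0} |vA|/|v|; i.e. this sup is bounded by
   some c < 1 (literal unfolding of "sup < 1"). *)
Definition opnorm_lt1 (n : nat) (A : 'M[R]_n) : Prop :=
  exists c : R, c < 1 /\
    forall v : 'rV[R]_n, v != 0 -> vnorm (v *m A) / vnorm v <= c.

Definition good_morphism (m : nat) (mu : seq (seq nat)) : Prop :=
  (1 <= m)%N /\
  size mu = m /\
  (forall a, (1 <= a <= m)%N -> word_over m (img mu a)) /\
  (exists x, x != [::] /\ img mu 1 = 1%N :: x) /\
  (forall a, (1 <= a <= m)%N -> (1 < size (img mu a))%N) /\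
  freq_matrix m mu \in unitmx /\
  opnorm_lt1 (invmx (freq_matrix m mu)).

(* Main.v *)
Require Import Defs.
From HB Require Import structures.
From mathcomp Require Import all_boot all_order all_fingroup all_algebra.
From mathcomp Require Import boolp Rstruct zify ring lra.
Set Implicit Arguments. Unset Strict Implicit. Unset Printing Implicit Defensive.

(* Let w be the fixed point, let V(p) be the Parikh vector of its prefix of
   length p, and attach to a tuple p_0, ..., p_k of positions its state: the
   letters w(p_i), the second differences D_i of the V(p_i), and the order of
   p_0 and p_1.  An Abelian k-power is a tuple with all D_i = 0 and p_0 < p_1.
   Every position is uniquely |mu(w[0..q))| + r with r < |mu(w(q))|, and since
   V(p) = V(q) M + Parikh(first r letters of mu(w(q))), the state of the tuple
   (p_i) is a function of the state of (q_i) and of the r_i.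

   M M^T - 1 is a positive definite integer matrix, so its determinant is at
   least 1, its inverse has explicitly bounded entries, and this gives an
   explicit K with (1 + 1/K)|v|^2 <= |vM|^2.  Hence an explicit bound on the D_i
   is inherited by the tuple (q_i), and only finitely many states occur on the
   way from (0, ..., 0) to an Abelian k-power.  A path without repeated states
   reaches the same final state at positions below an explicit bound, and a
   bounded search decides the question. *)

(** * Closure properties of computable functions *)

Definition computable (n : nat) (f : seq nat -> nat) : Prop :=
  exists P, forall s, size s = n -> prf_eval P s (f s).

Lemma computable_ext n f g : f =1 g -> computable n f -> computable n g.
Proof. by move=> fg [P hP]; exists P => s /hP; rewrite fg. Qed.

Lemma computable_var i n f : (forall s, f s = nth 0 s i) -> computable n f.
Proof. by move=> h; exists (PProj i) => s _; rewrite h; constructor. Qed.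

Lemma computable_succ n f : computable n f -> computable n (fun s => (f s).+1).
Proof.
move=> [P hP]; exists (PComp PSucc [:: P]) => s /hP h.
apply: (@ev_comp _ _ _ [:: f s]); last exact: (ev_succ [:: f s]).
by apply: evs_cons => //; apply: evs_nil.
Qed.

Lemma computable_cst n c : computable n (fun=> c).
Proof.
elim: c => [|c IH]; last exact: computable_succ.
by exists PZero => s _; constructor.
Qed.

Lemma computable_seq n (gs : seq (seq nat -> nat)) :
  (forall i, i < size gs -> computable n (nth (fun=> 0) gs i)) ->
  exists Ps, forall s, size s = n -> prf_evals Ps s [seq g s | g <- gs].
Proof.
elim: gs => [_|g gs IH h]; first by exists [::] => s _; constructor.
have [P hP] := h 0 isT.
have [i|Ps hPs] := IH; first exact: (h i.+1).
by exists (P :: Ps) => s hs; constructor; [exact: hP | exact: hPs].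
Qed.

Lemma computable_comp n f (gs : seq (seq nat -> nat)) :
  computable (size gs) f ->
  (forall i, i < size gs -> computable n (nth (fun=> 0) gs i)) ->
  computable n (fun s => f [seq g s | g <- gs]).
Proof.
move=> [P hP] /computable_seq [Ps hPs]; exists (PComp P Ps) => s hs.
by apply: ev_comp; [exact: hPs | apply: hP; rewrite size_map].
Qed.

Lemma computable_app1 n F f :
  computable 1 (fun s => F (nth 0 s 0)) -> computable n f ->
  computable n (fun s => F (f s)).
Proof.
move=> hF hf; apply: (@computable_comp n (fun s => F (nth 0 s 0)) [:: f]) => //.
by case.
Qed.

Lemma computable_app2 n F f g :
  computable 2 (fun s => F (nth 0 s 0) (nth 0 s 1)) ->
  computable n f -> computable n g -> computable n (fun s => F (f s) (g s)).
Proof.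
move=> hF hf hg.
apply: (@computable_comp n (fun s => F (nth 0 s 0) (nth 0 s 1)) [:: f; g]) => //.
by do 2?case.
Qed.

Lemma computable_app3 n F f g h :
  computable 3 (fun s => F (nth 0 s 0) (nth 0 s 1) (nth 0 s 2)) ->
  computable n f -> computable n g -> computable n h ->
  computable n (fun s => F (f s) (g s) (h s)).
Proof.
move=> hF hf hg hh.
apply: (@computable_comp n (fun s => F (nth 0 s 0) (nth 0 s 1) (nth 0 s 2))
  [:: f; g; h]) => //.
by do 3?case.
Qed.

(** [PPrim] hands its step program the index, the accumulator and then the original arguments, so
    [h] may depend on all of [s]; this is the reason for the two [behead]s. *)
Lemma computable_iteri n b z h :
  computable n b -> computable n z ->
  computable n.+2
    (fun s => h (behead (behead s)) (nth 0 s 0) (nth 0 s 1)) ->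
  computable n (fun s => iteri (b s) (h s) (z s)).
Proof.
move=> [Pb hb] [Pz hz] [Ph hh].
(* These [n] projections copy the arguments behind the loop bound. *)
have [|Ps hPs] := @computable_seq n (mkseq (fun i s => nth 0 s i) n).
  move=> i; rewrite size_mkseq => hi; exists (PProj i) => s _.
  by rewrite nth_mkseq //; constructor.
exists (PComp (PPrim Pz Ph) (Pb :: Ps)) => s hs.
apply: (@ev_comp _ _ _ (b s :: s)).
  constructor; first exact: hb.
  have := hPs s hs; suff -> : [seq g s | g <- mkseq (fun i s => nth 0 s i) n] = s by [].
  by rewrite -map_comp -[RHS](mkseq_nth 0) hs.
elim: (b s) => [|i IH] /=; first by constructor; apply: hz.
by apply: ev_primS IH _; apply: (hh (i :: _ :: s)); rewrite /= hs.
Qed.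

Ltac comp_var := by apply: computable_var => ?; rewrite ?nth_behead; reflexivity.

Lemma computable_pred n f : computable n f -> computable n (fun s => (f s).-1).
Proof.
apply: (@computable_app1 n predn).
apply: (@computable_ext _ (fun s => iteri (nth 0 s 0) (fun i _ => i) 0)).
  by move=> s; case: (nth 0 s 0).
by apply: computable_iteri; [comp_var | exact: computable_cst | comp_var].
Qed.

Lemma computable_add n f g :
  computable n f -> computable n g -> computable n (fun s => f s + g s).
Proof.
apply: (@computable_app2 n addn).
apply: (@computable_ext _ (fun s => iteri (nth 0 s 0) (fun _ r => r.+1) (nth 0 s 1))).
  by move=> s; elim: (nth 0 s 0) => //= x ->.
by apply: computable_iteri; [comp_var | comp_var | apply: computable_succ; comp_var].
Qed.

Lemma computable_sub n f g :
  computable n f -> computable n g -> computable n (fun s => f s - g s).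
Proof.
apply: (@computable_app2 n subn).
apply: (@computable_ext _ (fun s => iteri (nth 0 s 1) (fun _ r => r.-1) (nth 0 s 0))).
  by move=> s; elim: (nth 0 s 1) => [|x /= ->]; rewrite ?subn0 ?subnS.
by apply: computable_iteri; [comp_var | comp_var | apply: computable_pred; comp_var].
Qed.

Lemma computable_sum n b F :
  computable n b -> computable n.+1 (fun s => F (behead s) (nth 0 s 0)) ->
  computable n (fun s => \sum_(0 <= i < b s) F s i).
Proof.
move=> hb [P hP].
apply: (@computable_ext _ (fun s => iteri (b s) (fun i r => r + F s i) 0)).
  by move=> s; elim: (b s) => [|x /= ->]; rewrite ?big_nat_recr // big_geq.
apply: computable_iteri => //; first exact: computable_cst.
apply: computable_add; first by comp_var.
(* The summand reads the index and [s] but not the accumulator, so the projections skip argument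
   1. *)
have [|Ps hPs] := @computable_seq n.+2 ((fun s => nth 0 s 0) ::
    mkseq (fun i s => nth 0 s i.+2) n).
  case=> [|i] /=; first by move=> _; comp_var.
  by rewrite ltnS size_mkseq => hi; rewrite nth_mkseq //; comp_var.
exists (PComp P Ps) => s hs.
have {}hPs := hPs s hs; apply: ev_comp hPs _.
case: s hs => [|x [|y s]] //= [hs].
rewrite -map_comp.
have -> : [seq ((fun g => g [:: x, y & s]) \o (fun i s0 => nth 0 s0 i.+2)) i
          | i <- iota 0 n] = s by rewrite -[RHS](mkseq_nth 0) hs.
by apply: (hP (x :: s)); rewrite /= hs.
Qed.

Lemma computable_mul n f g :
  computable n f -> computable n g -> computable n (fun s => f s * g s).
Proof.
apply: (@computable_app2 n muln).
apply: (@computable_ext _ (fun s => \sum_(0 <= i < nth 0 s 0) nth 0 s 1)).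
  by move=> s; rewrite sum_nat_const_nat subn0.
by apply: computable_sum; comp_var.
Qed.

Lemma computable_exp n f g :
  computable n f -> computable n g -> computable n (fun s => f s ^ g s).
Proof.
apply: (@computable_app2 n expn).
apply: (@computable_ext _
  (fun s => iteri (nth 0 s 1) (fun _ r => nth 0 s 0 * r) 1)).
  by move=> s; elim: (nth 0 s 1) => //= x ->; rewrite expnS.
apply: computable_iteri; [comp_var | exact: computable_cst |].
by apply: computable_mul; comp_var.
Qed.

Lemma computable_fact n f : computable n f -> computable n (fun s => (f s)`!).
Proof.
apply: (@computable_app1 n factorial).
apply: (@computable_ext _ (fun s => iteri (nth 0 s 0) (fun i r => i.+1 * r) 1)).
  by move=> s; elim: (nth 0 s 0) => //= x ->; rewrite factS.
apply: computable_iteri; [comp_var | exact: computable_cst |].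
by apply: computable_mul; [apply: computable_succ|]; comp_var.
Qed.

Lemma computable_leq n f g :
  computable n f -> computable n g ->
  computable n (fun s => nat_of_bool (f s <= g s)).
Proof.
move=> hf hg; apply: (@computable_ext _ (fun s => 1 - (f s - g s))).
  by move=> s; rewrite /leq; case: (f s - g s).
apply: computable_sub; first exact: computable_cst.
exact: computable_sub.
Qed.

Lemma computable_eq n f g :
  computable n f -> computable n g ->
  computable n (fun s => nat_of_bool (f s == g s)).
Proof.
move=> hf hg; apply: (@computable_ext _
  (fun s => nat_of_bool (f s <= g s) * nat_of_bool (g s <= f s))).
  by move=> s; rewrite mulnb eqn_leq.
by apply: computable_mul; apply: computable_leq.
Qed.

Lemma computable_neg n (f : seq nat -> bool) :
  computable n (fun s => nat_of_bool (f s)) ->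
  computable n (fun s => nat_of_bool (~~ f s)).
Proof.
move=> hf; apply: (@computable_ext _ (fun s => 1 - nat_of_bool (f s))).
  by move=> s; case: (f s).
by apply: computable_sub => //; exact: computable_cst.
Qed.

Lemma sum_nat_lt a n : a <= n -> \sum_(0 <= i < n) (i < a) = a.
Proof.
move=> an; rewrite (big_cat_nat (n := a)) //=.
rewrite [X in _ + X]big_nat [X in _ + X]big1 => [|i /andP[h _]]; last first.
  by rewrite ltnNge h.
rewrite addn0 big_nat (eq_bigr (fun=> 1)) => [|i /andP[_ ->]] //.
by rewrite -big_nat sum_nat_const_nat subn0 muln1.
Qed.

Lemma computable_div n f g :
  computable n f -> computable n g -> computable n (fun s => f s %/ g s).
Proof.
apply: (@computable_app2 n divn).
(* The quotient counts the positive multiples of the divisor up to the dividend; the leading factor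
   gives the convention that division by 0 is 0. *)
apply: (@computable_ext _ (fun s => nat_of_bool (0 < nth 0 s 1) *
  \sum_(0 <= i < nth 0 s 0) nat_of_bool (i.+1 * nth 0 s 1 <= nth 0 s 0))).
  move=> s; set x := nth 0 s 0; set d := nth 0 s 1.
  case: (posnP d) => [->|d0]; first by rewrite divn0.
  rewrite mul1n big_nat /= (eq_bigr (fun i => nat_of_bool (i < x %/ d))); last first.
    by move=> i _; rewrite leq_divRL.
  by rewrite -big_nat sum_nat_lt // leq_div.
apply: computable_mul.
  by apply: computable_leq; [exact: computable_cst | comp_var].
apply: computable_sum; first by comp_var.
apply: computable_leq; last by comp_var.
by apply: computable_mul; [apply: computable_succ|]; comp_var.
Qed.

Lemma computable_mod n f g :
  computable n f -> computable n g -> computable n (fun s => f s %% g s).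
Proof.
move=> hf hg; apply: (@computable_ext _ (fun s => f s - f s %/ g s * g s)).
  by move=> s; rewrite {1}(divn_eq (f s) (g s)) addKn.
by apply: computable_sub => //; apply: computable_mul => //; apply: computable_div.
Qed.

(** * Arithmetic on codes of sequences *)

Ltac comp_step :=
  lazymatch goal with
  | |- computable _ (fun s => S (@?f s)) => apply: computable_succ
  | |- computable _ (fun s => predn (@?f s)) => apply: computable_pred
  | |- computable _ (fun s => addn (@?f s) (@?g s)) => apply: computable_add
  | |- computable _ (fun s => subn (@?f s) (@?g s)) => apply: computable_sub
  | |- computable _ (fun s => muln (@?f s) (@?g s)) => apply: computable_mul
  | |- computable _ (fun s => expn (@?f s) (@?g s)) => apply: computable_exp
  | |- computable _ (fun s => factorial (@?f s)) => apply: computable_fact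
  | |- computable _ (fun s => divn (@?f s) (@?g s)) => apply: computable_div
  | |- computable _ (fun s => modn (@?f s) (@?g s)) => apply: computable_mod
  | |- computable _ (fun s => iteri (@?f s) (@?g s) (@?h s)) =>
      apply: computable_iteri
  | |- computable _ (fun s => nat_of_bool (leq (@?f s) (@?g s))) =>
      apply: computable_leq
  | |- computable _ (fun s => nat_of_bool (negb (@?f s))) =>
      apply: computable_neg
  | |- computable _ (fun s => nat_of_bool (@?f s == @?g s)) =>
      apply: computable_eq
  | |- computable _ (fun s => bigop _ _ _) => apply: computable_sum
  end.

Ltac comp_auto :=
  repeat first [assumption | exact: computable_cst | comp_step | solve [comp_var]].

Lemma computable_cantor n f g : computable n f -> computable n g ->
  computable n (fun s => cantor_pair (f s) (g s)).
Proof. by move=> hf hg; rewrite /cantor_pair; comp_auto. Qed.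

(** The pairing is inverted by exhaustive search: by injectivity at most one pair contributes, and
    both its components are below [c]. The code 0 of the empty list gives 0. *)
Definition code_head (c : nat) : nat :=
  \sum_(0 <= x < c) \sum_(0 <= y < c) x * (c == (cantor_pair x y).+1).

Definition code_tail (c : nat) : nat :=
  \sum_(0 <= x < c) \sum_(0 <= y < c) y * (c == (cantor_pair x y).+1).

Lemma computable_head n f :
  computable n f -> computable n (fun s => code_head (f s)).
Proof.
apply: (@computable_app1 n code_head); rewrite /code_head.
by comp_auto; apply: computable_cantor; comp_auto.
Qed.

Lemma computable_tail n f :
  computable n f -> computable n (fun s => code_tail (f s)).
Proof.
apply: (@computable_app1 n code_tail); rewrite /code_tail.
by comp_auto; apply: computable_cantor; comp_auto.
Qed.

Lemma cantor_pairE x y : cantor_pair x y = 'C((x + y).+1, 2) + y.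
Proof. by rewrite bin2 /cantor_pair mulnC divn2. Qed.

Lemma cantor_pair_inj x y x' y' :
  cantor_pair x y = cantor_pair x' y' -> x = x' /\ y = y'.
Proof.
(* Codes of pairs with x + y = s lie between C(s+1,2) and C(s+1,2) + s, and these intervals are
   disjoint for distinct s. *)
have gap s t : s < t -> 'C(s.+1, 2) + s < 'C(t.+1, 2).
  move=> st; apply: (@leq_trans 'C(s.+2, 2)); last exact: leq_bin2l.
  by rewrite [in leqRHS]binS bin1 -addnS.
rewrite !cantor_pairE => h.
have [lt|lt|e] := ltngtP (x + y) (x' + y').
- have := gap _ _ lt; rewrite ltnNge => /negP[].
  rewrite (leq_trans (leq_addr y' _)) // -h leq_add2l; exact: leq_addl.
- have := gap _ _ lt; rewrite ltnNge => /negP[].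
  rewrite (leq_trans (leq_addr y _)) // h leq_add2l; exact: leq_addl.
- move: h; rewrite e => /addnI ey; split=> //.
  by apply: (@addIn y); rewrite e ey.
Qed.

Lemma leq_cantor_l x y : x <= cantor_pair x y.
Proof.
rewrite cantor_pairE binS bin1 (leq_trans _ (leq_addr _ _)) //.
by rewrite (leq_trans _ (leq_addl _ _)) // leq_addr.
Qed.

Lemma leq_cantor_r x y : y <= cantor_pair x y.
Proof. by rewrite /cantor_pair leq_addl. Qed.

Lemma sum_cantor (h : nat -> nat -> nat) x y :
  let c := (cantor_pair x y).+1 in
  \sum_(0 <= x' < c) \sum_(0 <= y' < c) h x' y' * (c == (cantor_pair x' y').+1)
  = h x y.
Proof.
move=> c; have hx : x < c by rewrite ltnS leq_cantor_l.
have hy : y < c by rewrite ltnS leq_cantor_r.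
rewrite big_mkord (bigD1 (Ordinal hx)) //= [X in _ + X]big1 ?addn0 => [|i ix].
  rewrite big_mkord (bigD1 (Ordinal hy)) //= [X in _ + X]big1 ?addn0 => [|j jy].
    by rewrite eqxx muln1.
  case: eqP; last by rewrite muln0.
  case=> /cantor_pair_inj[_ e]; case/eqP: jy; exact: val_inj.
rewrite big1 // => j _; case: eqP; last by rewrite muln0.
case=> /cantor_pair_inj[e _]; case/eqP: ix; exact: val_inj.
Qed.

Lemma code_headE s : code_head (encode_seq s) = head 0 s.
Proof.
case: s => [|x s]; first by rewrite /code_head big_geq.
exact: (sum_cantor (fun x _ => x)).
Qed.

Lemma code_tailE s : code_tail (encode_seq s) = encode_seq (behead s).
Proof.
case: s => [|x s]; first by rewrite /code_tail big_geq.
exact: (sum_cantor (fun _ y => y)).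
Qed.

Definition code_drop (c i : nat) : nat := iteri i (fun=> code_tail) c.
Definition code_nth (c i : nat) : nat := code_head (code_drop c i).
(** The length is the number of non-empty suffixes; a list is never longer than its code, so [c]
    bounds the search. *)
Definition code_size (c : nat) : nat := \sum_(0 <= i < c) (code_drop c i != 0).

Lemma computable_drop n f g : computable n f -> computable n g ->
  computable n (fun s => code_drop (f s) (g s)).
Proof.
apply: (@computable_app2 n code_drop); rewrite /code_drop.
by comp_auto; apply: computable_tail; comp_auto.
Qed.

Lemma computable_nth n f g : computable n f -> computable n g ->
  computable n (fun s => code_nth (f s) (g s)).
Proof. by move=> hf hg; apply: computable_head; apply: computable_drop. Qed.

Lemma computable_size n f :
  computable n f -> computable n (fun s => code_size (f s)).
Proof.
apply: (@computable_app1 n code_size); rewrite /code_size.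
by comp_auto; apply: computable_drop; comp_auto.
Qed.

Lemma code_dropE s i : code_drop (encode_seq s) i = encode_seq (drop i s).
Proof.
elim: i => [|i IH]; first by rewrite drop0.
rewrite /code_drop /= -/(code_drop _ i) IH code_tailE.
by rewrite -[behead _]drop1 drop_drop add1n.
Qed.

Lemma code_nthE s i : code_nth (encode_seq s) i = nth 0 s i.
Proof. by rewrite /code_nth code_dropE code_headE -nth0 nth_drop addn0. Qed.

Lemma encode_seq_eq0 s : (encode_seq s == 0) = (s == [::]).
Proof. by case: s. Qed.

Lemma size_encode s : size s <= encode_seq s.
Proof.
by elim: s => //= x s IH; rewrite ltnS (leq_trans IH) // leq_cantor_r.
Qed.

Lemma mem_encode s x : x \in s -> x <= encode_seq s.
Proof.
elim: s => //= y s IH; rewrite inE => /orP[/eqP->|/IH h].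
  exact/leqW/leq_cantor_l.
by apply/leqW/(leq_trans h)/leq_cantor_r.
Qed.

Lemma code_sizeE s : code_size (encode_seq s) = size s.
Proof.
rewrite /code_size -[RHS](sum_nat_lt (size_encode s)); apply: eq_bigr => i _.
by rewrite code_dropE encode_seq_eq0 -size_eq0 size_drop subn_eq0 -ltnNge.
Qed.

Definition code_img (c a : nat) : nat := code_nth c a.-1.

Lemma computable_img n f g : computable n f -> computable n g ->
  computable n (fun s => code_img (f s) (g s)).
Proof. by move=> hf hg; apply: computable_nth => //; apply: computable_pred. Qed.

Lemma code_imgE mu a : code_img (encode_morphism mu) a = encode_seq (img mu a).
Proof.
rewrite /code_img code_nthE /img; case: (ltnP a.-1 (size mu)) => h.
  by rewrite (nth_map [::]).
by rewrite !nth_default ?size_map.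
Qed.

(** This lets the code of mu itself serve as the bound [c] on image lengths, and so on the entries
    of M, in all explicit constants. *)
Lemma size_img_encode mu a : size (img mu a) <= encode_morphism mu.
Proof.
rewrite (leq_trans (size_encode _)) // /img.
case: (ltnP a.-1 (size mu)) => h; last by rewrite nth_default.
by apply: mem_encode; apply/map_f/mem_nth.
Qed.

Definition digit (b h t : nat) : nat := h %/ b ^ t %% b.

Lemma computable_digit n f g h : computable n f -> computable n g ->
  computable n h -> computable n (fun s => digit (f s) (g s) (h s)).
Proof. by move=> hf hg hh; rewrite /digit; comp_auto. Qed.

(* [h] stores the letters at positions [< n] as its base-[b] digits; the letter
   at [n] is the [r]-th letter of the image of the [q]-th one, where the images
   of the letters before [q] have total length [n - r]. *)
Definition next_letter (b c n h : nat) : nat :=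
  (n == 0) + (0 < n) * \sum_(0 <= q < n) \sum_(0 <= r < n.+1)
    (\sum_(0 <= t < q) code_size (code_img c (digit b h t)) + r == n) *
    ((r < code_size (code_img c (digit b h q))) *
     code_nth (code_img c (digit b h q)) r).

Definition history (b c n : nat) : nat :=
  iteri n (fun i h => h + b ^ i * next_letter b c i h) 0.

Definition letter (b c n : nat) : nat := digit b (history b c n.+1) n.

Lemma computable_letter n f g h : computable n f -> computable n g ->
  computable n h -> computable n (fun s => letter (f s) (g s) (h s)).
Proof.
apply: (@computable_app3 n letter); rewrite /letter /history /next_letter.
by repeat (comp_auto; first
  [ apply: computable_digit | apply: computable_nth
  | apply: computable_size | apply: computable_img ]).
Qed.

(** * Computing the letters of the fixed point *)

(** For a fixed point [w], this is the position in [w] where the block mu(w(q)) begins. *)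
Definition start (mu : seq (seq nat)) (w : nat -> nat) (q : nat) : nat :=
  \sum_(0 <= t < q) size (img mu (w t)).

(** The last clause is the equation mu(w) = w, read block by block. *)
Definition fixed_word (m : nat) (mu : seq (seq nat)) (w : nat -> nat) : Prop :=
  [/\ w 0 = 1, forall n, 0 < w n <= m,
      forall n, 1 < size (img mu (w n)) &
      forall q r, r < size (img mu (w q)) ->
        w (start mu w q + r) = nth 0 (img mu (w q)) r].

Lemma startS mu w q : start mu w q.+1 = start mu w q + size (img mu (w q)).
Proof. by rewrite /start big_nat_recr. Qed.

Section FixedWord.
Variables (m : nat) (mu : seq (seq nat)) (w : nat -> nat).
Hypothesis hw : fixed_word m mu w.
Let L q := size (img mu (w q)).

(** Every image has at least two letters. Hence the position q whose block contains a nonzero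
    position n is strictly below n, which drives the inductions on positions. *)
Lemma start_ge q : 2 * q <= start mu w q.
Proof.
have [_ _ h _] := hw; elim: q => // q IH.
by rewrite startS; have := h q; lia.
Qed.

Lemma start_homo p q : p < q -> start mu w p + L p <= start mu w q.
Proof.
elim: q => // q IH; rewrite ltnS leq_eqVlt startS => /orP[/eqP-> //|/IH h].
exact: leq_trans h (leq_addr _ _).
Qed.

Lemma start_inj p q r s : r < L p -> s < L q ->
  start mu w p + r = start mu w q + s -> p = q /\ r = s.
Proof.
move=> hr hs h; have [lt|lt|e] := ltngtP p q.
- by have := start_homo lt; lia.
- by have := start_homo lt; lia.
- by subst q; split=> //; lia.
Qed.

(** Blocks are consecutive intervals, so positions are ordered lexicographically by block and
    offset. This determines how the order of two positions evolves under desubstitution. *)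
Lemma start_ltn p q r s : r < L p -> s < L q ->
  (start mu w p + r < start mu w q + s) = (p < q) || (p == q) && (r < s).
Proof.
move=> hr hs; have [lt|lt|e] := ltngtP p q.
- by have := start_homo lt; rewrite /=; lia.
- by have := start_homo lt; rewrite /=; lia.
- by subst q; rewrite /= ltn_add2l.
Qed.

Lemma start_ex n : exists q r, r < L q /\ n = start mu w q + r.
Proof.
have [_ _ hL _] := hw.
elim: n => [|n [q [r [hr ->]]]].
  by exists 0, 0; split; [apply: leq_trans (hL 0) | rewrite /start big_geq].
have [h|h] := leqP (L q) r.+1.
  by exists q.+1, 0; split; [apply: leq_trans (hL _) | rewrite startS -/(L q); lia].
by exists q, r.+1; split=> //; lia.
Qed.

Lemma digitE n (d : nat -> nat) t : (forall i, d i <= m) -> t < n ->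
  digit m.+1 (\sum_(0 <= i < n) m.+1 ^ i * d i) t = d t.
Proof.
move=> hd; elim: n t d hd => // n IH t d hd.
rewrite big_nat_recl // expn0 mul1n.
rewrite (eq_bigr (fun i => m.+1 * (m.+1 ^ i * d i.+1))); last first.
  by move=> i _; rewrite expnS mulnA.
rewrite -big_distrr /= => ht; rewrite /digit.
case: t ht => [_|t ht].
  by rewrite expn0 divn1 addnC mulnC modnMDl modn_small // ltnS.
rewrite expnS divnMA addnC [m.+1 * _]mulnC divnMDl // [d 0 %/ _]divn_small ?ltnS // addn0.
exact: (IH t (fun i => d i.+1)).
Qed.

Lemma sum_nat_pick n (F : nat -> nat) q :
  q < n -> (forall i, i != q -> F i = 0) -> \sum_(0 <= i < n) F i = F q.
Proof.
move=> hq h; rewrite big_mkord (bigD1 (Ordinal hq)) //= big1 ?addn0 // => i iq.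
by apply: h.
Qed.

Let c := encode_morphism mu.

Lemma next_letterE n h : (forall t, t < n -> digit m.+1 h t = w t) ->
  next_letter m.+1 c n h = w n.
Proof.
move=> hd; have [w0 _ hL hs] := hw; rewrite /next_letter.
case: (posnP n) => [->|n0]; first by rewrite mul0n w0.
rewrite ?n0 add0n mul1n.
have [q [r [hr en]]] := start_ex n.
(* The letter at q is therefore already stored in [h]. *)
have qn : q < n.
  case: q hr en => // q _ ->; have := start_ge q.+1; lia.
rewrite big_nat (eq_bigr (fun q => \sum_(0 <= r < n.+1)
   (start mu w q + r == n) * ((r < L q) * nth 0 (img mu (w q)) r))); last first.
  move=> q' /= hq'; apply: eq_bigr => r' _.
  rewrite hd // !code_imgE code_nthE code_sizeE; congr ((_ + _ == _) * _).
  rewrite /start big_nat [RHS]big_nat; apply: eq_bigr => t /= ht.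
  by rewrite hd ?code_imgE ?code_sizeE //; lia.
rewrite -big_nat.
(* The decomposition of n into block and offset is unique, so the double sum has a single possibly
   nonzero term. *)
have zero q' r' : (q' != q) || (r' != r) ->
   (start mu w q' + r' == n) * ((r' < L q') * nth 0 (img mu (w q')) r') = 0.
  case: (start mu w q' + r' =P n) => // e ne; case: ltnP => // hr'; exfalso.
  have [e1 e2] := start_inj hr' hr (etrans e en).
  by move: ne; rewrite e1 e2 !eqxx.
rewrite (sum_nat_pick qn); last first.
  by move=> q' hq'; rewrite big1 // => r' _; rewrite zero ?hq'.
have rn : r < n.+1 by rewrite en ltnS leq_addl.
rewrite (sum_nat_pick rn); last by move=> r' hr'; rewrite zero // hr' orbT.
by rewrite -en eqxx hr !mul1n -hs // -en.
Qed.

Lemma historyE n : history m.+1 c n = \sum_(0 <= i < n) m.+1 ^ i * w i.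
Proof.
have [_ hm _ _] := hw.
elim: n => [|n IH]; first by rewrite big_geq.
rewrite big_nat_recr //= -IH /history /= -/(history _ _ _) next_letterE //.
move=> t ht; rewrite IH digitE // => i; by case/andP: (hm i).
Qed.

Lemma letterE n : letter m.+1 c n = w n.
Proof.
by have [_ hm _ _] := hw; rewrite /letter historyE digitE // => i; case/andP: (hm i).
Qed.

End FixedWord.

(** * Bounded search for Abelian powers *)

Definition block_count (w : nat -> nat) (i l a : nat) : nat :=
  \sum_(0 <= t < l) (w (i + t) == a).

(** Tests k consecutive blocks of common length [l] from position [i]. Mismatches between
    neighbouring blocks are added up so that the test is a computable sum. *)
Definition power_at (m : nat) (w : nat -> nat) (k i l : nat) : bool :=
  (0 < l) && (0 == \sum_(0 <= j < k.-1) \sum_(0 <= a < m.+1)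
    (block_count w (i + j * l) l a != block_count w (i + j.+1 * l) l a)).

(* With M the frequency matrix and entries of M at most [c]: bounds for the
   entries of M M^T - 1, for the constant K in (1 + 1/K)|v|^2 <= |vM|^2, for the
   squared norm of a second difference, which has to be at least 2K(1+2K)|d|^2
   for every perturbation d occurring in one desubstitution step, for the number
   of states, and for the positions reached by a path without repeated states. *)
Definition gram_entry_bound (m c : nat) := m * c ^ 2 + 1.
Definition gram_inv_bound (m c : nat) := m * (m`! * gram_entry_bound m c ^ m).
Definition diff_bound (m c : nat) :=
  2 * gram_inv_bound m c * (1 + 2 * gram_inv_bound m c) * (m * (2 * c) ^ 2).
Definition state_bound (m c k : nat) :=
  m.+1 ^ k.+1 * ((2 * diff_bound m c).+1 ^ (k.-1 * m)) * 4.
Definition position_bound (m c k : nat) := c.+1 ^ state_bound m c k.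

Definition power_free_bit (m c k : nat) : nat :=
  0 == \sum_(0 <= i < position_bound m c k) \sum_(0 <= l < position_bound m c k)
    power_at m (letter m.+1 c) k i l.

Lemma computable_power_free_bit :
  computable 3
    (fun s => power_free_bit (nth 0 s 0) (nth 0 s 1) (nth 0 s 2)).
Proof.
apply: (@computable_ext _ (fun s =>
  let m := nth 0 s 0 in let c := nth 0 s 1 in let k := nth 0 s 2 in
  nat_of_bool (0 == \sum_(0 <= i < position_bound m c k)
    \sum_(0 <= l < position_bound m c k)
      (0 < l) * (0 == \sum_(0 <= j < k.-1) \sum_(0 <= a < m.+1)
        (\sum_(0 <= t < l) (letter m.+1 c (i + j * l + t) == a) !=
         \sum_(0 <= t < l) (letter m.+1 c (i + j.+1 * l + t) == a)))))).
  move=> s /=; rewrite /power_free_bit; congr nat_of_bool; congr (_ == _).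
  by apply: eq_bigr => i _; apply: eq_bigr => l _; rewrite mulnb.
rewrite /position_bound /state_bound /diff_bound /gram_inv_bound /gram_entry_bound.
by cbv zeta; repeat (comp_auto; apply: computable_letter).
Qed.

(** * The fixed point and its Abelian powers *)

Lemma morph_apply_cat mu s t :
  morph_apply mu (s ++ t) = morph_apply mu s ++ morph_apply mu t.
Proof. by rewrite /morph_apply map_cat flatten_cat. Qed.

Lemma morph_apply_mkseqS mu w q :
  morph_apply mu (mkseq w q.+1) = morph_apply mu (mkseq w q) ++ img mu (w q).
Proof. by rewrite mkseqS -cats1 morph_apply_cat /morph_apply /= cats0. Qed.

Lemma size_morph_mkseq mu w q : size (morph_apply mu (mkseq w q)) = start mu w q.
Proof.
elim: q => [|q IH]; first by rewrite /start big_geq.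
by rewrite morph_apply_mkseqS size_cat IH startS.
Qed.

Lemma omega_fixed_word m mu : good_morphism m mu -> fixed_word m mu (omega_word mu).
Proof.
move=> [m0 [_ [himg [[x [x0 hx]] [hsz _]]]]].
(* The words mu^n(1) form a chain of prefixes of lengths above n, so each of them agrees with the
   fixed point on its whole length. *)
pose u n := iter n (morph_apply mu) [:: 1].
have u_word n : word_over m (u n).
  elim: n => [|n IH] /=; first by rewrite m0.
  rewrite /word_over /morph_apply; elim: (u n) IH => //= a s IHs /andP[ha hs].
  by rewrite all_cat; apply/andP; split; [apply: himg | apply: IHs].
have u_step n : prefix (u n) (u n.+1).
  elim: n => [|n /prefixP[v hv]].
    by apply/prefixP; exists x; rewrite /u /= /morph_apply /= hx cats0.
  change (prefix (morph_apply mu (u n)) (morph_apply mu (u n.+1))).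
  by rewrite hv morph_apply_cat prefix_prefix.
have u_mono n d : prefix (u n) (u (d + n)).
  by elim: d => [|d IH]; [exact: prefix_refl | exact: prefix_trans IH (u_step _)].
have u_size n : n < size (u n).
  elim: n => // n IH; suff : 2 * size (u n) <= size (u n.+1) by lia.
  rewrite /= /morph_apply; elim: (u n) (u_word n) => //= a s IHs /andP[ha hs].
  by rewrite size_cat; have := hsz a ha; have := IHs hs; lia.
have prefix_nth s t i : prefix s t -> i < size s -> nth 0 t i = nth 0 s i.
  by move=> /prefixP[v ->] h; rewrite nth_cat h.
have uE n i : i < size (u n) -> nth 0 (u n) i = omega_word mu i.
  move=> h; rewrite /omega_word -/(u i.+1).
  have [le|le] := leqP n i.+1.
    by rewrite -(prefix_nth _ _ _ (u_mono n (i.+1 - n))) // subnK.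
  rewrite -(prefix_nth _ _ _ (u_mono i.+1 (n - i.+1))) ?subnK //; first exact: ltnW.
  exact: ltn_trans (u_size _).
have mk q : take q (u q) = mkseq (omega_word mu) q.
  have hq := ltnW (u_size q).
  apply: (@eq_from_nth _ 0); first by rewrite size_takel // size_mkseq.
  rewrite size_takel // => i hi; rewrite nth_take // nth_mkseq // uE //.
  exact: leq_trans hi hq.
have w_word n : 0 < omega_word mu n <= m.
  rewrite -(uE n n) //; exact: (allP (u_word n)) _ (mem_nth _ (u_size n)).
split=> // [|n|q r hr]; [by rewrite -(uE 0) | exact: hsz |].
(* Split mu^(q+1)(1) after its first q+1 letters, which are those of the fixed point, and apply mu:
   the block of the letter at q becomes visible. *)
have e : u q.+2 = (morph_apply mu (mkseq (omega_word mu) q) ++ img mu (omega_word mu q))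
    ++ morph_apply mu (drop q.+1 (u q.+1)).
  rewrite -morph_apply_mkseqS -mk -morph_apply_cat.
  by rewrite cat_take_drop.
rewrite -(uE q.+2) e.
  rewrite nth_cat size_cat size_morph_mkseq ltn_add2l hr nth_cat size_morph_mkseq.
  by rewrite ltnNge leq_addr addKn.
by rewrite !size_cat size_morph_mkseq -addnA ltn_add2l (leq_trans hr) // leq_addr.
Qed.

Lemma anagram_size u v : anagram u v -> size u = size v.
Proof.
by move=> h; apply: perm_size; apply/allP => a _ /=; rewrite h.
Qed.

Lemma block_countE mu i l a :
  block_count (omega_word mu) i l a = count_mem a (omega_factor mu i l).
Proof.
elim: l i => [|l IH] i; first by rewrite /block_count big_geq.
rewrite /block_count big_nat_recl //= addn0; congr (_ + _).
by rewrite -IH; apply: eq_bigr => t _; rewrite addSnnS.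
Qed.

Lemma omega_factorD mu i l l' :
  omega_factor mu i (l + l') = omega_factor mu i l ++ omega_factor mu (i + l) l'.
Proof. by rewrite /omega_factor iotaD map_cat. Qed.

Lemma omega_factor_blocks mu l X i len :
  all (fun x => size x == l) X -> omega_factor mu i len = flatten X ->
  forall j, j < size X -> nth [::] X j = omega_factor mu (i + j * l) l.
Proof.
elim: X i len => // x X IH i len /= /andP[/eqP hx hX] h.
have hlen : len = l + (len - l).
  have : size (omega_factor mu i len) = len by rewrite size_map size_iota.
  by rewrite h size_cat hx => <-; rewrite addKn.
move: h; rewrite hlen omega_factorD => /eqP; rewrite eqseq_cat; last first.
  by rewrite size_map size_iota.
move=> /andP[/eqP e1 /eqP e2] [|j] hj /=; first by rewrite addn0.
by rewrite (IH _ _ hX e2) // mulSn addnA.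
Qed.

Lemma flatten_blocks mu l k i :
  flatten (mkseq (fun j => omega_factor mu (i + j * l) l) k) = omega_factor mu i (k * l).
Proof.
elim: k => [|k IH] //.
by rewrite mkseqS flatten_rcons IH mulSn [l + _]addnC omega_factorD.
Qed.

Lemma power_atP m w k i l : reflect
  (0 < l /\ forall j a, j < k.-1 -> a <= m ->
     block_count w (i + j * l) l a = block_count w (i + j.+1 * l) l a)
  (power_at m w k i l).
Proof.
rewrite /power_at eq_sym; apply: (iffP andP) => [[l0]|[l0 h]].
  rewrite sum_nat_seq_eq0 => /allP h; split=> // j a hj ha.
  have := h j; rewrite mem_index_iota hj /= => /(_ isT).
  rewrite sum_nat_seq_eq0 => /allP/(_ a); rewrite mem_index_iota ltnS ha /=.
  by move=> /(_ isT); rewrite eqb0 negbK => /eqP.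
split=> //; rewrite big_nat big1 // => j hj; rewrite big_nat big1 // => a ha.
by rewrite h ?eqxx.
Qed.

(** Anagrams have equal lengths, so an Abelian k-power is determined by its start and one common
    block length, which is positive because the power is non-empty. *)
Lemma not_free_power_at m mu k : good_morphism m mu -> 0 < k ->
  omega_abelian_power_free mu k <-> forall i l, ~~ power_at m (omega_word mu) k i l.
Proof.
move=> hg k0; have [_ hm _ _] := omega_fixed_word hg; split=> [hf i l|h i len].
  apply/negP => /power_atP[l0 h]; apply: (hf i (k * l)); split.
    by rewrite -size_eq0 size_map size_iota -lt0n muln_gt0 k0.
  exists (mkseq (fun j => omega_factor mu (i + j * l) l) k).
  rewrite size_mkseq flatten_blocks; split=> //; split=> // j hj a.
  rewrite !nth_mkseq //; last exact: ltnW.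
  have [ha|ha] := leqP a m; first by rewrite -!block_countE h //; lia.
  (* Letters above [m] never occur, so comparing letters up to [m] suffices. *)
  have z s l' : count_mem a (omega_factor mu s l') = 0.
    apply/count_memPn/mapP => -[t _ e]; have := hm t; rewrite -e; lia.
  by rewrite !z.
move=> [w0 [X [hX [e hana]]]].
have hsz j : j < k -> size (nth [::] X j) = size (nth [::] X 0).
  elim: j => // j IH hj; rewrite -IH ?(ltnW hj) //.
  by apply/esym/anagram_size/hana.
set l := size (nth [::] X 0).
have hall : all (fun x => size x == l) X.
  by apply/(all_nthP [::]) => j; rewrite hX => /hsz ->.
have hb := omega_factor_blocks hall e.
have /negP[] := h i l; apply/power_atP; split.
  (* With block length 0 all blocks, and hence the whole factor, would be empty. *)
  rewrite lt0n; apply: contra w0 => /eqP l0; rewrite e.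
  move: hall; rewrite l0; elim: X {hX e hana hsz l l0 hb h} => //= x X IH.
  by case: x.
move=> j a hj _; rewrite !block_countE -!hb ?hX; try lia.
by apply: hana; lia.
Qed.

(** * An explicit expansion constant *)

Import Order.TTheory GRing.Theory Num.Theory.
Local Open Scope ring_scope.

Definition sqnorm (S : pzRingType) (n : nat) (v : 'rV[S]_n) : S := \sum_j v 0 j ^+ 2.

Lemma sqnormE (S : comPzRingType) n (v : 'rV[S]_n) : sqnorm v = (v *m v^T) 0 0.
Proof. by rewrite mxE; apply: eq_bigr => j _; rewrite mxE expr2. Qed.

Lemma sqnorm_ge0 (S : realDomainType) n (v : 'rV[S]_n) : 0 <= sqnorm v.
Proof. by apply: sumr_ge0 => j _; apply: sqr_ge0. Qed.

(** Leibniz expansion: n! signed products of n entries each. *)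
Lemma det_bound (S : realDomainType) n (A : 'M[S]_n) (a : S) :
  (forall i j, `|A i j| <= a) -> `|\det A| <= (n`!)%:R * a ^+ n.
Proof.
move=> hA; apply: (le_trans (ler_norm_sum _ _ _)).
rewrite -card_Sn -sum1_card natr_sum mulr_suml; apply: ler_sum => s _.
rewrite mul1r normrM normrX normrN1 expr1n mul1r normr_prod.
rewrite -[X in _ ^+ X]card_ord -prodr_const; apply: ler_prod => i _.
by rewrite normr_ge0 hA.
Qed.

Lemma sqnorm_sum_norm (S : realFieldType) n (v : 'rV[S]_n) :
  \sum_i \sum_j `|v 0 i| * `|v 0 j| <= n%:R * sqnorm v.
Proof.
have -> : n%:R * sqnorm v = \sum_(i < n) \sum_(j < n) (v 0 i ^+ 2 + v 0 j ^+ 2) / 2.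
  under eq_bigr => i _ do rewrite -mulr_suml big_split sumr_const card_ord /=.
  rewrite -mulr_suml big_split /= sumr_const card_ord sumrMnl -/(sqnorm v).
  by rewrite -mulr_natl; field.
apply: ler_sum => i _; apply: ler_sum => j _.
have := sqr_ge0 (`|v 0 i| - `|v 0 j|).
rewrite -(real_normK (num_real (v 0 i))) -(real_normK (num_real (v 0 j))).
move: `|_| `|_| => x y; lra.
Qed.

Lemma ler_sum_ord (S : numDomainType) n (F : 'I_n -> S) (a : S) :
  (forall i, F i <= a) -> \sum_i F i <= n%:R * a.
Proof.
move=> h; apply: (le_trans (ler_sum _ (fun i _ => h i))).
by rewrite sumr_const card_ord mulr_natl.
Qed.

Section Expansion.
Variables (n c : nat) (Z : 'M[int]_n).
Let M : 'M[R]_n := map_mx intr Z.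
Hypothesis n0 : (0 < n)%N.
Hypothesis Zc : forall i j, 0 <= Z i j <= c%:Z.
Hypothesis M_unit : M \in unitmx.
Hypothesis M_exp : opnorm_lt1 (invmx M).

Let gram : 'M[R]_n := M *m M^T - 1%:M.
Let K : R := (gram_inv_bound n c)%:R.

Let vnorm_sq (v : 'rV[R]_n) : vnorm v ^+ 2 = sqnorm v.
Proof. by rewrite sqr_sqrtr ?sqnorm_ge0. Qed.

Let gramE (v : 'rV[R]_n) : (v *m gram *m v^T) 0 0 = sqnorm (v *m M) - sqnorm v.
Proof.
rewrite !sqnormE trmx_mul /gram mulmxBr mulmxBl mulmx1 !mulmxA.
by rewrite !mxE.
Qed.

(** Applying the norm hypothesis to vM gives |v| <= e|vM| with e < 1, so |v| < |vM| for nonzero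
    v. *)
Let gram_pos (v : 'rV[R]_n) : v != 0 -> 0 < (v *m gram *m v^T) 0 0.
Proof.
move=> v0; rewrite gramE subr_gt0; have [e [e1 he]] := M_exp.
have vK : v *m M *m invmx M = v by rewrite mulmxK.
have u0 : v *m M != 0 by apply: contra v0 => /eqP h; rewrite -vK h mul0mx.
have pos (u : 'rV[R]_n) : u != 0 -> 0 < vnorm u.
  move=> nz; rewrite lt_def sqrtr_ge0 andbT; apply: contra nz => /eqP h.
  have : sqnorm u = 0 by rewrite -vnorm_sq h expr0n.
  move/psumr_eq0P => hz; apply/eqP/rowP => j; rewrite mxE; apply/eqP.
  by rewrite -sqrf_eq0 hz // => i _; apply: sqr_ge0.
have := he _ u0; rewrite vK ler_pdivrMr ?pos // => h.
rewrite -!vnorm_sq ltr_pXn2r ?nnegrE ?sqrtr_ge0 //.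
by apply: le_lt_trans h _; rewrite gtr_pMl ?pos.
Qed.

Let gram_unit : gram \in unitmx.
Proof.
rewrite unitmxE unitfE; apply/negP => /det0P[v v0 hv].
by have := gram_pos v0; rewrite hv mul0mx mxE ltxx.
Qed.

(** An entry of the inverse is a cofactor over the determinant. The Leibniz bound controls the
    cofactor, and the determinant has absolute value at least 1. *)
Let gram_inv_entry i j :
  `|invmx gram i j| <= ((n`! * gram_entry_bound n c ^ n)%N)%:R.
Proof.
pose G : 'M[int]_n := Z *m Z^T - 1%:M.
have gG : gram = map_mx intr G.
  by rewrite /gram /G map_mxB map_mxM map_trmx map_mx1.
have hG i' j' : `|G i' j'| <= (gram_entry_bound n c)%:Z.
  rewrite !mxE (le_trans (ler_normB _ _)) // /gram_entry_bound PoszD lerD //; last first.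
    by case: eqP.
  rewrite (le_trans (ler_norm_sum _ _ _)) // PoszM -[X in X * _]natz.
  apply: ler_sum_ord => t; rewrite mxE normrM.
  have [/andP[h1 h2] /andP[h3 h4]] := (Zc i' t, Zc j' t).
  by rewrite !ger0_norm // -mulnn PoszM ler_pM.
(* The determinant is a nonzero integer. *)
have hdet : 1 <= `|\det gram|.
  have := gram_unit; rewrite unitmxE unitfE gG det_map_mx intr_eq0 => nz.
  by rewrite -intr_norm -[X in X <= _]/(1%:~R) ler_int; move: nz; lia.
rewrite /invmx gram_unit mxE normrM normfV.
rewrite ler_pdivrMl ?(lt_le_trans ltr01) //.
apply: (@le_trans _ _ ((n`! * gram_entry_bound n c ^ n)%N%:R)); last first.
  by rewrite ler_peMl.
rewrite mxE /cofactor normrM normrX normrN1 expr1n mul1r gG.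
rewrite -map_col' -map_row' det_map_mx -intr_norm -[leRHS]/((Posz _)%:~R) ler_int.
apply: le_trans (@det_bound _ _ _ (gram_entry_bound n c)%:Z _) _.
  by move=> i' j'; rewrite mxE mxE.
rewrite -[(gram_entry_bound n c)%:Z]natz -natrX -natrM natz lez_nat.
(* The cofactor has size n - 1; its bound (n-1)! a^(n-1) is at most n! a^n because a >= 1. *)
case: n n0 => // n' _; rewrite factS expnS /=.
apply: leq_mul; rewrite leq_pmull // /gram_entry_bound addn1 //.
Qed.

(** Let G be [gram], b = v G v^T and u = v G^-1. Positivity of G at v - u/K reads b - 2|v|^2/K + u
    v^T/K^2 >= 0, and u v^T <= K|v|^2 by the entry bound on G^-1; together b >= |v|^2/K. *)
Lemma expansion_bound (v : 'rV[int]_n) :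
  sqnorm v <= (gram_inv_bound n c)%:Z * (sqnorm (v *m Z) - sqnorm v).
Proof.
pose vr : 'rV[R]_n := map_mx intr v.
suff h : sqnorm vr <= K * (sqnorm (vr *m M) - sqnorm vr).
  move: h; rewrite /vr -map_mxM.
  have cast (u : 'rV[int]_n) : sqnorm (map_mx intr u : 'rV[R]_n) = (sqnorm u)%:~R.
    rewrite /sqnorm rmorph_sum; apply: eq_bigr => j _.
    by rewrite mxE rmorphXn.
  by rewrite !cast /K -[_%:R]/((Posz _)%:~R) -rmorphB -rmorphM ler_int.
rewrite -gramE.
have Kpos : 0 < K.
  by rewrite ltr0n /gram_inv_bound /gram_entry_bound !muln_gt0 n0 fact_gt0 expn_gt0 addn1.
pose W := invmx gram; pose u := vr *m W.
set b := _ 0 0.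
have gramT : gram^T = gram by rewrite /gram linearB /= trmx_mul trmxK trmx1.
have hpos : 0 <= ((vr - K^-1 *: u) *m gram *m (vr - K^-1 *: u)^T) 0 0.
  have [->|nz] := eqVneq (vr - K^-1 *: u) 0; first by rewrite mul0mx mul0mx mxE.
  exact/ltW/gram_pos.
have uG : u *m gram = vr by rewrite /u mulmxKV.
have quadT (x y : 'rV[R]_n) : (x *m y^T) 0 0 = (y *m x^T) 0 0.
  by rewrite -[x]trmxK -trmx_mul mxE trmxK.
have e : ((vr - K^-1 *: u) *m gram *m (vr - K^-1 *: u)^T) 0 0 =
    b - 2 * K^-1 * sqnorm vr + K^-1 ^+ 2 * (u *m vr^T) 0 0.
  rewrite [(vr - _)^T]raddfB /= [(_ *: u)^T]linearZ /= mulmxBr !mulmxBl.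
  rewrite -!scalemxAl -!scalemxAr -?scalemxAl uG.
  have -> : vr *m gram *m u^T = (u *m gram *m vr^T)^T.
    by rewrite !trmx_mul trmxK gramT mulmxA.
  rewrite uG /b sqnormE -(quadT vr u).
  move: (vr *m gram *m vr^T) (vr *m vr^T) (vr *m u^T) => X Y Y'.
  by rewrite !mxE; ring.
have hq : (u *m vr^T) 0 0 <= K * sqnorm vr.
  rewrite /K /gram_inv_bound mulnC natrM -mulrA.
  apply: le_trans (ler_wpM2l (ler0n _ _) (sqnorm_sum_norm vr)).
  rewrite mxE mulr_sumr; apply: ler_sum => j _.
  rewrite [u 0 j]mxE [vr^T j 0]mxE mulr_suml mulr_sumr.
  apply: ler_sum => i _; apply: (le_trans (ler_norm _)); rewrite !normrM.
  rewrite mulrAC mulrC [`|vr 0 j| * _]mulrC.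
  by apply: ler_wpM2r (gram_inv_entry i j); rewrite mulr_ge0.
have {}hpos : 0 <= b - K^-1 * sqnorm vr.
  have : K^-1 ^+ 2 * (u *m vr^T) 0 0 <= K^-1 ^+ 2 * (K * sqnorm vr).
    by apply: ler_wpM2l => //; rewrite sqr_ge0.
  rewrite mulrA expr2 -[_ * _ * K]mulrA mulVf ?gt_eqF // mulr1.
  rewrite e in hpos; move: hpos; lra.
by rewrite -ler_pdivrMl // -subr_ge0.
Qed.
End Expansion.

(** * The graph of states *)

Definition parikh (m : nat) (s : seq nat) : 'rV[int]_m :=
  \row_a (count_mem (a.+1 : nat) s)%:Z.

Definition freq_int (m : nat) (mu : seq (seq nat)) : 'M[int]_m :=
  \matrix_(i, j) (count_mem (j.+1 : nat) (img mu i.+1))%:Z.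

Definition diff2 (V : zmodType) (x : nat -> V) (i : nat) : V :=
  x i.+2 - x i.+1 *+ 2 + x i.

Lemma parikh_cat m s t : parikh m (s ++ t) = parikh m s + parikh m t.
Proof. by apply/rowP => a; rewrite !mxE count_cat PoszD. Qed.

Section Graph.
Variables (m : nat) (mu : seq (seq nat)) (k : nat).
Hypothesis hg : good_morphism m mu.
Let w := omega_word mu.
Let c := encode_morphism mu.
Let hw : fixed_word m mu w := omega_fixed_word hg.
Let B : int := (diff_bound m c)%:Z.

Let len (a : nat) := size (img mu a).
Let prefix_vec (p : nat) : 'rV[int]_m := parikh m (mkseq w p).
Let tail_vec (p r : nat) : 'rV[int]_m := parikh m (take r (img mu (w p))).
(** For increasing positions, vanishing at [i] says that the factors from [p i] to [p i.+1] and from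
    [p i.+1] to [p i.+2] are anagrams. *)
Let diff (p : nat -> nat) (i : nat) : 'rV[int]_m := diff2 (fun j => prefix_vec (p j)) i.

Let m0 : (0 < m)%N. Proof. by case: hg. Qed.

Lemma mkseq_start p r : (r < len (w p))%N ->
  mkseq w (start mu w p + r) = morph_apply mu (mkseq w p) ++ take r (img mu (w p)).
Proof.
have [_ _ _ hs] := hw; elim: r => [|r IH] hr.
  rewrite addn0 take0 cats0; elim: p {hr} => [|p IH].
    by rewrite /start big_geq.
  rewrite startS morph_apply_mkseqS -IH.
  have h s : (s <= len (w p))%N ->
      mkseq w (start mu w p + s) = mkseq w (start mu w p) ++ take s (img mu (w p)).
    elim: s => [|s IHs] hs'; first by rewrite addn0 take0 cats0.
    by rewrite addnS mkseqS IHs ?(ltnW hs') // hs // rcons_cat (take_nth 0%N).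
  by rewrite h // take_size.
by rewrite addnS mkseqS IH ?(ltnW hr) // hs ?(ltnW hr) // rcons_cat (take_nth 0%N) // ltnW.
Qed.

Lemma parikh_morph p : parikh m (morph_apply mu (mkseq w p)) = prefix_vec p *m freq_int m mu.
Proof.
have [_ hm _ _] := hw; elim: p => [|p IH].
  apply/rowP => a; rewrite !mxE big1 // => i _; rewrite !mxE mul0r //.
rewrite morph_apply_mkseqS parikh_cat IH /prefix_vec mkseqS -cats1 parikh_cat mulmxDl.
congr (_ + _); apply/rowP => a; rewrite !mxE.
have hlt : ((w p).-1 < m)%N by have := hm p; lia.
have wp : (w p).-1.+1 = w p by have := hm p; lia.
rewrite (bigD1 (Ordinal hlt)) //= big1 ?addr0 => [|i hi].
  by rewrite !mxE /= wp eqxx addn0 mul1r.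
rewrite !mxE /= addn0; case: eqP => [e|]; last by rewrite mul0r.
by case/eqP: hi; apply: val_inj; rewrite /= e.
Qed.

(** Each [q i] lies in the block that is the image of the letter at [p i], with offset [r i]; thus
    [p] is the desubstitution of [q]. *)
Definition descends (p q : nat -> nat) : Prop :=
  exists r : nat -> nat, forall i, (i <= k)%N ->
    (r i < len (w (p i)))%N /\ q i = (start mu w (p i) + r i)%N.

Lemma prefix_vec_start p r : (r < len (w p))%N ->
  prefix_vec (start mu w p + r) = prefix_vec p *m freq_int m mu + tail_vec p r.
Proof. by move=> hr; rewrite /prefix_vec mkseq_start // parikh_cat parikh_morph. Qed.

Lemma diff_step p q r i : (i < k.-1)%N ->
  (forall i, (i <= k)%N -> (r i < len (w (p i)))%N /\ q i = (start mu w (p i) + r i)%N) ->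
  diff q i = diff p i *m freq_int m mu + diff2 (fun j => tail_vec (p j) (r j)) i.
Proof.
move=> hi h; have e j : (j <= i.+2)%N -> prefix_vec (q j) =
    prefix_vec (p j) *m freq_int m mu + tail_vec (p j) (r j).
  move=> hj; have [|hr ->] := h j; first by lia.
  exact: prefix_vec_start.
rewrite /diff /diff2 !e //; last by lia.
rewrite !mulr2n !(mulmxDl, mulNmx).
move: (prefix_vec (p i) *m _) (prefix_vec (p i.+1) *m _) (prefix_vec (p i.+2) *m _).
by move=> X Y Z; apply/rowP => a; rewrite !mxE; ring.
Qed.

Definition state := (seq nat * seq 'rV[int]_m * (bool * bool))%type.

(** Both the strict order and the equality of [p 0] and [p 1] are recorded: when they coincide, the
    offsets decide the order after one step. *)
Definition state_of (p : nat -> nat) : state :=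
  (mkseq (fun i => w (p i)) k.+1, mkseq (diff p) k.-1, ((p 0 < p 1)%N, p 0%N == p 1%N)).

(** Some pair of representing tuples suffices here, since [descend_sim] transfers the step to every
    tuple with state [s]. *)
Definition edge (s t : state) : bool :=
  `[< exists p q, [/\ state_of p = s, state_of q = t & descends p q] >].

Definition bounded_state (s : state) : Prop :=
  exists2 p, s = state_of p & forall i, (i < k.-1)%N -> sqnorm (diff p i) <= B.

Lemma mkseq_eq (T : Type) (f g : nat -> T) n :
  mkseq f n = mkseq g n -> forall i, (i < n)%N -> f i = g i.
Proof.
move=> e i hi; have := congr1 (fun s => nth (f i) s i) e.
by rewrite !nth_mkseq.
Qed.

(** Reuse the offsets of [q] above [p']. They fit because the letters agree, and the new letters,
    second differences and order depend only on the old state and the offsets. *)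
Lemma descend_sim p p' q : (0 < k)%N -> state_of p = state_of p' -> descends p q ->
  exists2 q', descends p' q' & state_of q' = state_of q.
Proof.
move=> k0 e [r hr].
have e1 : (state_of p).1.1 = (state_of p').1.1 by rewrite e.
have e2 : (state_of p).1.2 = (state_of p').1.2 by rewrite e.
have e3 : (state_of p).2.1 = (state_of p').2.1 by rewrite e.
have e4 : (state_of p).2.2 = (state_of p').2.2 by rewrite e.
rewrite /= in e1 e2 e3 e4.
have ew i : (i <= k)%N -> w (p i) = w (p' i).
  by move=> hi; apply: (mkseq_eq e1 hi).
have hr' i : (i <= k)%N -> (r i < len (w (p' i)))%N.
  by move=> hi; rewrite -ew //; case: (hr i hi).
pose q' i := (start mu w (p' i) + r i)%N.
have hq' i : (i <= k)%N -> (r i < len (w (p' i)))%N /\ q' i = (start mu w (p' i) + r i)%N.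
  by move=> hi; split; first exact: hr'.
exists q'; first by exists r.
have hqE i : (i <= k)%N -> q i = (start mu w (p i) + r i)%N by move=> hi; case: (hr i hi).
have hr1 i : (i <= k)%N -> (r i < len (w (p i)))%N by move=> hi; case: (hr i hi).
have [_ _ _ hs] := hw.
congr (_, _, _).
- apply: (@eq_from_nth _ 0%N); rewrite !size_mkseq // => i hi.
  rewrite !nth_mkseq // /q' hqE // !hs ?hr' ?hr1 // ew //.
- apply: (@eq_from_nth _ 0); rewrite !size_mkseq // => i hi.
  rewrite !nth_mkseq // (diff_step hi hq') (diff_step hi hr) (mkseq_eq e2) //.
  by congr (_ + _); rewrite /diff2 /tail_vec !ew //; lia.
- rewrite /q' !hqE // !start_ltn ?hr' ?hr1 // e3 e4; congr pair.
  have inj a b : (forall i, (i <= k)%N -> (r i < len (w (a i)))%N) -> b = a -> 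
     (start mu w (a 0) + r 0 == start mu w (a 1) + r 1)%N = (a 0 == a 1)%N && (r 0 == r 1)%N.
    move=> ha _; apply/eqP/andP => [e5|[/eqP-> /eqP-> //]].
    by have [-> ->] := start_inj (ha 0%N isT) (ha 1%N k0) e5.
  by rewrite !(inj _ _ _ erefl) // e4.
Qed.

Hypothesis k0 : (0 < k)%N.

Lemma state_ext p p' : (forall i, (i <= k)%N -> p i = p' i) -> state_of p = state_of p'.
Proof.
move=> h; rewrite /state_of !h //; congr (_, _, _).
- by apply: (@eq_from_nth _ 0%N); rewrite !size_mkseq // => i hi; rewrite !nth_mkseq // h.
- apply: (@eq_from_nth _ 0); rewrite !size_mkseq // => i hi; rewrite !nth_mkseq //.
  by rewrite /diff /diff2 !h //; lia.
Qed.

Lemma start_le p : (start mu w p <= p * c)%N.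
Proof.
rewrite /start; apply: (@leq_trans (\sum_(0 <= t < p) c)%N).
  by apply: leq_sum => t _; apply: size_img_encode.
by rewrite sum_nat_const_nat subn0.
Qed.

(** A path of states lifts step by step to tuples starting from the given [p0]. As start(p) + r <
    (p+1)c, each step multiplies the position bound by at most c + 1. *)
Lemma lift_path p0 ss : path edge (state_of p0) ss ->
  exists2 p, state_of p = last (state_of p0) ss &
    forall i, (i <= k)%N -> (p i < (p0 i).+1 * c.+1 ^ size ss)%N.
Proof.
elim: ss p0 => [|s ss IH] p0 /=.
  by move=> _; exists p0 => // i _; rewrite expn0 muln1.
case/andP=> /asboolP[p [q [ep eq hpq]]] hpath.
have [q' [r hr] eq'] := descend_sim k0 ep hpq.
rewrite -eq -eq' in hpath *; have [p1 e1 h1] := IH _ hpath; exists p1 => // i hi.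
apply: leq_trans (h1 i hi) _; rewrite expnS mulnA leq_mul2r; apply/orP; right.
have [hri ->] := hr i hi; have := start_le (p0 i).
have : (len (w (p0 i)) <= c)%N by apply: size_img_encode.
by move: hri; set a := start _ _ _; rewrite mulnS mulSn [(_ * c)%N]mulnC; lia.
Qed.

(** * Inheritance of the bound on second differences *)

Let K := gram_inv_bound m c.

(** Young's inequality with the weight 1 + 1/(2K), chosen below the expansion factor 1 + 1/K.
    Coordinatewise the two sides differ by the square of x + 2Ky. *)
Lemma sqnormB_le (x y : 'rV[int]_m) :
  2 * K%:Z * sqnorm (x - y) <=
  (2 * K%:Z + 1) * sqnorm x + 2 * K%:Z * (1 + 2 * K%:Z) * sqnorm y.
Proof.
rewrite /sqnorm !mulr_sumr -big_split /=; apply: ler_sum => j _; rewrite !mxE.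
rewrite -subr_ge0; set d := _ - _.
have -> : d = (x 0 j + 2 * K%:Z * y 0 j) ^+ 2 by rewrite /d; ring.
exact: sqr_ge0.
Qed.

Lemma sqnorm_tail p r i :
  sqnorm (diff2 (fun j => tail_vec (p j) (r j)) i) <= (m * (2 * c) ^ 2)%N%:Z.
Proof.
rewrite PoszM -[m%:Z]natz; apply: ler_sum_ord => a; rewrite /diff2 !mxE.
have h j : (count_mem (a.+1 : nat) (take (r j) (img mu (w (p j)))) <= c)%N.
  apply: leq_trans (count_size _ _) _; apply: leq_trans (size_img_encode mu (w (p j))).
  by rewrite size_take; case: ltnP => // /ltnW.
move: (h i) (h i.+1) (h i.+2); move: (count _ _) (count _ _) (count _ _) => x y z hx hy hz.
rewrite ?mulr2n -mulnn [in leRHS]PoszM -expr2; set u : int := _ - _ + _.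
have [h1 h2] : - (2 * c)%N%:Z <= u /\ u <= (2 * c)%N%:Z by rewrite /u; split; lia.
by rewrite -[leLHS]real_normK ?num_real // lerXn2r ?nnegrE // ler_norml h1 h2.
Qed.

Lemma freq_map : map_mx intr (freq_int m mu) = freq_matrix m mu.
Proof. by apply/matrixP => i j; rewrite !mxE. Qed.

(** With E and D the second differences of [p] and [q], EM = D - t. Expansion gives (K+1)|E|^2 <=
    K|EM|^2, Young's inequality gives 2K|EM|^2 <= (2K+1)B + B, and K + 1 cancels. *)
Lemma descend_bound p q : descends p q ->
  (forall i, (i < k.-1)%N -> sqnorm (diff q i) <= B) ->
  forall i, (i < k.-1)%N -> sqnorm (diff p i) <= B.
Proof.
move=> [r hr] hq i hi.
have [_ [_ [_ [_ [_ [hu ho]]]]]] := hg.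
have hc a b : 0 <= freq_int m mu a b <= c%:Z.
  rewrite mxE /= lez_nat (leq_trans (count_size _ _)) //; exact: size_img_encode.
rewrite -freq_map in hu ho.
have := expansion_bound m0 hc hu ho (diff p i).
have := hq i hi; have e := diff_step hi hr; have := sqnorm_tail p r i.
set t := diff2 _ _ in e *.
have := sqnormB_le (diff q i) t.
have -> : diff q i - t = diff p i *m freq_int m mu by rewrite e addrK.
have -> : B = 2 * K%:Z * (1 + 2 * K%:Z) * (m * (2 * c) ^ 2)%N%:Z.
  by rewrite /B /diff_bound -/K 2!PoszM PoszD !PoszM.
have K0 : 0 <= K%:Z by [].
move: (sqnorm _) (sqnorm _) (sqnorm _) (sqnorm _) K0 (Posz (m * _)%N) => sE st sD sx.
rewrite -/K; move: (K%:Z) => L L0 C h1 h2 h3 h4.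
pose Q := 2 * L * (1 + 2 * L); rewrite -/Q in h1 h3 *.
have Q0 : 0 <= Q by rewrite /Q; nia.
have a1 : (2 * L + 1) * sD <= (2 * L + 1) * (Q * C) by apply: ler_wpM2l => //; lia.
have a2 : Q * st <= Q * C by apply: ler_wpM2l.
have : (L + 1) * sE <= (L + 1) * (Q * C) by move: (Q * C) a1 a2 h1 h4 => T; lia.
by rewrite ler_pM2l //; lia.
Qed.

Lemma diff_const n i : diff (fun=> n) i = 0.
Proof. by rewrite /diff /diff2 mulr2n opprD addrA subrr add0r addNr. Qed.

(** Desubstitute all coordinates repeatedly. Positions at least halve each time, so the zero tuple
    is reached, and every tuple on the way inherits the bound. *)
Lemma reach n p : (forall i, (i <= k)%N -> (p i <= n)%N) ->
  (forall i, (i < k.-1)%N -> sqnorm (diff p i) <= B) ->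
  let s0 := state_of (fun=> 0%N) in
  exists ss, [/\ path edge s0 ss, last s0 ss = state_of p &
    {in s0 :: ss, forall s, bounded_state s}].
Proof.
move=> + + s0; elim: n p => [|n IH] p hp hB.
  exists [::]; split=> // [|s].
    by apply: state_ext => i /hp; rewrite leqn0 => /eqP.
  rewrite inE => /eqP ->; exists (fun=> 0%N) => // i _.
  by rewrite diff_const /sqnorm big1 // => j _; rewrite mxE expr0n.
have /choice[q /choice[r hr]] : forall i, exists q r,
    (r < len (w q))%N /\ p i = (start mu w q + r)%N.
  by move=> i; apply: start_ex hw _.
have hqp : descends q p by exists r => i _; apply: hr.
have [||ss [h1 h2 h3]] := IH q.
- move=> i /hp; have [_ ->] := hr i; have := start_ge hw (q i); lia.
- exact: descend_bound hqp hB.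
exists (rcons ss (state_of p)); split.
- rewrite rcons_path h1 h2; apply/asboolP; by exists q, p.
- by rewrite last_rcons.
- move=> s; rewrite -rcons_cons mem_rcons inE => /orP[/eqP->|/h3 //].
  by exists p.
Qed.

(** * Finiteness of the bounded states and short paths *)

Let Bn := diff_bound m c.
Let code_type : finType :=
  ({ffun 'I_k.+1 -> 'I_m.+1} * {ffun 'I_k.-1 * 'I_m -> 'I_(2 * Bn).+1} * (bool * bool))%type.

(** Coordinates of bounded second differences lie between -B and B; adding B makes them naturals up
    to 2B, on which [inord] is faithful. *)
Let code (s : state) : code_type :=
  ([ffun i : 'I_k.+1 => inord (nth 0%N s.1.1 i)],
   [ffun ia : 'I_k.-1 * 'I_m => inord (absz ((nth 0 s.1.2 ia.1) 0 ia.2 + Bn%:Z))], s.2).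

Lemma code_inj s t : bounded_state s -> bounded_state t -> code s = code t -> s = t.
Proof.
have [_ hm _ _] := hw.
move=> [p -> hp] [q -> hq] e.
have e1 : (code (state_of p)).1.1 = (code (state_of q)).1.1 by rewrite e.
have e2 : (code (state_of p)).1.2 = (code (state_of q)).1.2 by rewrite e.
have e3 : (code (state_of p)).2 = (code (state_of q)).2 by rewrite e.
rewrite /state_of; congr (_, _, _); last exact: e3.
- apply: (@eq_from_nth _ 0%N); rewrite !size_mkseq // => i hi.
  have /ffunP/(_ (Ordinal hi)) := e1; rewrite !ffunE /= => /(congr1 val) /=.
  by rewrite !inordK // !nth_mkseq //= ltnS; case/andP: (hm (p i)); case/andP: (hm (q i)).
- apply: (@eq_from_nth _ 0); rewrite !size_mkseq // => i hi.
  apply/rowP => a.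
  have /ffunP/(_ (Ordinal hi, a)) := e2; rewrite !ffunE /= => /(congr1 val) /=.
  rewrite !nth_mkseq //.
  (* For an integer x, |x| <= x^2, so the bound on the squared norm also bounds each coordinate. *)
  have bound (x : 'rV[int]_m) : sqnorm x <= B -> `|x 0 a| <= Bn%:Z.
    rewrite /sqnorm (bigD1 a) //= => h.
    have {h} : x 0 a ^+ 2 <= Bn%:Z.
      apply: le_trans h; rewrite lerDl.
      by apply: sumr_ge0 => j _; apply: sqr_ge0.
    rewrite -real_normK ?num_real //; move: `|_| (normr_ge0 (x 0 a)) => y y0.
    by rewrite expr2; nia.
  have := bound _ (hp i hi); have := bound _ (hq i hi).
  move: (diff p i 0 a) (diff q i 0 a) => x y hx hy.
  by rewrite !inordK; lia.
Qed.

Lemma card_code : #|code_type| = state_bound m c k.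
Proof.
by rewrite !card_prod !card_ffun card_prod !card_ord card_bool /state_bound.
Qed.

(** Remove repetitions from a path given by [reach]. Its states are bounded with distinct codes, so
    it has fewer steps than there are codes; lifting it from the zero tuple gives small
    positions. *)
Lemma short_tuple p : (forall i, (i < k.-1)%N -> sqnorm (diff p i) <= B) ->
  exists2 q, state_of q = state_of p & forall i, (i <= k)%N -> (q i < position_bound m c k)%N.
Proof.
move=> hB.
have [|ss [h1 h2 h3]] := @reach (\max_(i < k.+1) p i)%N p _ hB.
  by move=> i hi; apply: (@leq_bigmax _ (fun i : 'I_k.+1 => p i) (Ordinal (hi : (i < k.+1)%N))).
case/shortenP: h1 h2 => ss' hpath hu hsub hlast.
have [q eq hq] := lift_path hpath; exists q; first by rewrite eq.
move=> i hi; apply: (leq_trans (hq i hi)); rewrite mul1n; apply: leq_pexp2l => //.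
have hb : {in state_of (fun=> 0%N) :: ss', forall s, bounded_state s}.
  move=> s; rewrite inE => /orP[/eqP->|/hsub hs]; apply: h3; rewrite inE ?eqxx ?hs ?orbT //.
have : uniq (map code (state_of (fun=> 0%N) :: ss')).
  by rewrite map_inj_in_uniq // => s t hs ht; apply: code_inj; apply: hb.
move/card_uniqP; rewrite size_map => hc.
by rewrite -card_code (leq_trans (leqnSn _)) // -[X in (X <= _)%N]hc max_card.
Qed.

(** * From states back to Abelian powers *)

Lemma block_count_prefix i l a :
  count_mem a (mkseq w (i + l)) = (count_mem a (mkseq w i) + block_count w i l a)%N.
Proof.
elim: l => [|l IH]; first by rewrite /block_count big_geq ?addn0.
rewrite addnS mkseqS -cats1 count_cat IH /block_count big_nat_recr //= addn0.
by rewrite addnA.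
Qed.

(** Summing coordinates turns a vanishing second difference of Parikh vectors into one of positions,
    so blocks get equal lengths. *)
Lemma sum_prefix_vec p : \sum_a prefix_vec p 0 a = p%:Z.
Proof.
have [_ hm _ _] := hw.
elim: p => [|p IH]; first by rewrite big1 // => a _; rewrite mxE.
have hlt : ((w p).-1 < m)%N by have := hm p; lia.
have wp : (w p).-1.+1 = w p by have := hm p; lia.
rewrite /prefix_vec mkseqS -cats1 parikh_cat.
under eq_bigr => a _ do rewrite mxE.
rewrite big_split /= IH (bigD1 (Ordinal hlt)) //= big1 => [|i hi].
  by rewrite mxE /= wp eqxx; lia.
rewrite mxE /= addn0; case: eqP => // e.
by case/eqP: hi; apply: val_inj; rewrite /= e.
Qed.

Lemma sum_diff2 (x : nat -> 'rV[int]_m) i :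
  \sum_a diff2 x i 0 a = diff2 (fun j => \sum_a x j 0 a) i.
Proof.
rewrite /diff2 -sumrMnl -sumrB -big_split; apply: eq_bigr => a _.
by move: (x i) (x i.+1) (x i.+2) => X Y Z; rewrite !mxE mulr2n.
Qed.

(** The end points of the blocks have all second differences 0 and [p 0 < p 1]. A small tuple with
    the same state shares both properties and is therefore again a power. *)
Lemma power_at_small i l : power_at m w k i l ->
  exists i' l', [/\ (i' < position_bound m c k)%N, (l' < position_bound m c k)%N
    & power_at m w k i' l'].
Proof.
move=> /power_atP[l0 h]; pose p j := (i + j * l)%N.
have pS j : p j.+1 = (p j + l)%N by rewrite /p mulSn; lia.
have diff_p j : (j < k.-1)%N -> diff p j = 0.
  move=> hj; apply/rowP => a; rewrite /diff /diff2 !mxE.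
  have := h j a.+1 hj (ltn_ord a); rewrite -/(p j) -/(p j.+1).
  have := block_count_prefix (p j) l a.+1.
  have := block_count_prefix (p j.+1) l a.+1; rewrite -!pS; lia.
have [|q eq hq] := @short_tuple p.
  move=> j hj; rewrite diff_p // /sqnorm big1 // => a _; by rewrite mxE expr0n.
have e2 : mkseq (diff q) k.-1 = mkseq (diff p) k.-1 by move: (congr1 (fun s => s.1.2) eq).
have e3 : (q 0 < q 1)%N = (p 0 < p 1)%N by move: (congr1 (fun s => s.2.1) eq).
have {}diff_q j : (j < k.-1)%N -> diff q j = 0.
  by move=> hj; rewrite (mkseq_eq e2 hj) diff_p.
have lt01 : (q 0 < q 1)%N by rewrite e3 /p mul0n mul1n addn0 -addn1 leq_add2l.
set d := (q 1 - q 0)%N.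
have step j : (j < k.-1)%N -> (q j.+2)%:Z - (q j.+1)%:Z *+ 2 + (q j)%:Z = 0.
  move=> hj; have := congr1 (fun v : 'rV[int]_m => \sum_a v 0 a) (diff_q j hj).
  rewrite [RHS]big1 => [|a _]; last by rewrite mxE.
  by rewrite sum_diff2 /diff2 !sum_prefix_vec.
(* The recurrence has order two, so the induction carries two consecutive terms of the arithmetic
   progression. *)
have qE j : (j < k)%N -> q j = (q 0 + j * d)%N /\ q j.+1 = (q 0 + j.+1 * d)%N.
  elim: j => [|j IH] hj; first by rewrite /d; lia.
  have [] := IH (ltnW hj); have := step j; rewrite mulr2n !mulSn; lia.
exists (q 0), d; split; [exact: hq | by apply: leq_ltn_trans (hq 1%N k0); apply: leq_subr |].
apply/power_atP; split; first by rewrite subn_gt0.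
move=> j a hj ha; have hj1 : (j.+1 < k)%N by lia.
have [e0 e1] := qE j (ltnW hj1); have [_ e2'] := qE j.+1 hj1.
rewrite -e0 -e1; have := block_count_prefix (q j) d a.
have := block_count_prefix (q j.+1) d a.
have -> : (q j.+1 + d)%N = q j.+2 by rewrite e1 e2' !mulSn; lia.
have -> : (q j + d)%N = q j.+1 by rewrite e0 e1 !mulSn; lia.
(* Parikh coordinate a counts the letter a + 1; the value 0 has no coordinate and is treated apart,
   as it never occurs in the word. *)
case: a ha => [_|a ha].
  have [_ hm _ _] := hw.
  have z s : count_mem 0%N (mkseq w s) = 0%N.
    by apply/count_memPn/mapP => -[t _ e]; have := hm t; rewrite -e.
  by rewrite !z; lia.
have := congr1 (fun v : 'rV[int]_m => v 0 (Ordinal ha)) (diff_q j hj).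
by rewrite /diff /diff2 !mxE /=; lia.
Qed.
End Graph.

(** * Correctness of the decision procedure *)

Lemma power_free_bitE m mu k : good_morphism m mu -> (0 < k)%N ->
  power_free_bit m (encode_morphism mu) k = `[< omega_abelian_power_free mu k >].
Proof.
move=> hg k0; rewrite /power_free_bit.
have -> : letter m.+1 (encode_morphism mu) = omega_word mu.
  by apply/funext => n; apply/letterE/omega_fixed_word.
congr nat_of_bool; rewrite eq_sym; apply/idP/asboolP.
  move=> h; apply/(not_free_power_at hg k0) => i l; apply/negP.
  move=> /(power_at_small hg k0)[i' [l' [hi hl hp]]].
  move: h; rewrite sum_nat_seq_eq0 => /allP/(_ i'); rewrite mem_index_iota hi.
  move=> /(_ isT); rewrite sum_nat_seq_eq0 => /allP/(_ l').
  by rewrite mem_index_iota hl hp => /(_ isT).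
move/(not_free_power_at hg k0) => h.
by rewrite big1 // => i _; rewrite big1 // => l _; rewrite (negPf (h i l)).
Qed.

Theorem theorem1 :
  exists P : prf,
    forall (m : nat) (mu : seq (seq nat)) (k : nat),
      good_morphism m mu -> (0 < k)%N ->
      (omega_abelian_power_free mu k ->
         prf_eval P [:: m; encode_morphism mu; k] 1%N) /\
      (~ omega_abelian_power_free mu k ->
         prf_eval P [:: m; encode_morphism mu; k] 0%N).
Proof.
have [P hP] := computable_power_free_bit; exists P => m mu k hg k0.
have := hP [:: m; encode_morphism mu; k] erefl.
rewrite /nth power_free_bitE //.
by case: asboolP => hf ev; split=> // /(_ hf).
Qed.
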